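(* Let $n\ge 1$ and let $\lambda\in\mathbb{R}^n$ satisfy $\lambda_1\ge\lambda_2\ge\dots\ge\lambda_n$ and $\lambda_i-\lambda_j\in\mathbb{Z}$ for all $i,j$. Let $q\le r$ be the integers in $[1,n]$ such that $$\lambda=(\underbrace{\lambda_1,\dots,\lambda_1}_{q},\underbrace{\lambda_1-1,\dots,\lambda_1-1}_{r-q},\lambda_{r+1},\dots,\lambda_n),\qquad \lambda_1-2\ge\lambda_{r+1}\ge\dots\ge\lambda_n .$$ Then: (1) If for some integer $i\in[1,q]$ $$\lambda_1<-n+\frac{r+q-i+1}{2},$$ then for every nonzero Schmid module $s=(2b_1,\dots,2b_n)$, $b_j\in\mathbb{Z}$, $b_1\ge\dots\ge b_n\ge 0$, with at most $i$ nonzero components, one has $$\|(\lambda-s)^++\rho\|^2>\|\lambda+\rho\|^2 .$$ (2) If $$\lambda_1<-n+\frac{r+1}{2},$$ then $\|(\lambda-s)^++\rho\|^2>\|\lambda+\rho\|^2$ holds for every nonzero Schmid module $s=(2b_1,\dots,2b_n)$, $b_j\in\mathbb{Z}$, $b_1\ge\dots\ge b_n\ge 0$.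
   Context: This is the case $\mathfrak{g}_0=\mathfrak{sp}(2n,\mathbb{R})$. Here $\rho=(n,n-1,\dots,2,1)$ and $\|\cdot\|$ is the standard Euclidean norm on $\mathbb{R}^n$. The Weyl group $W_{\mathfrak{k}}$ acts on $\mathbb{R}^n$ by all permutations of the coordinates, and for $\mu\in\mathbb{R}^n$, $\mu^+$ denotes the unique $W_{\mathfrak{k}}$-conjugate of $\mu$ with coordinates in weakly decreasing order. A Schmid module is identified with an $n$-tuple $s=(2b_1,\dots,2b_n)$ with integers $b_1\ge\dots\ge b_n\ge 0$. (If $r=n$, there are no coordinates $\lambda_{r+1},\dots,\lambda_n$.) *)

(* Defs.v *)
From HB Require Import structures.
From mathcomp Require Import all_boot all_order all_fingroup all_algebra.
From mathcomp Require Import reals.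

Set Implicit Arguments.
Unset Strict Implicit.
Unset Printing Implicit Defensive.

Import Order.TTheory GRing.Theory Num.Theory.
Local Open Scope ring_scope.

Definition weakly_decreasing (R : numDomainType) (n : nat) (mu : 'rV[R]_n) :
    Prop :=
  forall i j : 'I_n, (i <= j)%N -> mu 0 j <= mu 0 i.

(* The library's norm on row vectors is the sup norm, hence this definition. *)
Definition enorm (R : realType) (n : nat) (v : 'rV[R]_n) : R :=
  Num.sqrt (\sum_(i < n) v 0 i ^+ 2).

(* (n, n - 1, ..., 2, 1); the coordinate indices start at 0. *)
Definition rho (R : realType) (n : nat) : 'rV[R]_n := \row_(i < n) (n - i)%:R.

(* mu^+ is obtained by sorting the coordinates of mu in weakly decreasing
   order; dominantP and dominant_unique show that it is the unique weakly
   decreasing vector in the orbit of mu under permutation of coordinates. *)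
Definition dominant (R : realType) (n : nat) (mu : 'rV[R]_n) : 'rV[R]_n :=
  \row_(i < n) nth 0 (sort >=%R [seq mu 0 j | j <- enum 'I_n]) i.

Lemma dominantP (R : realType) (n : nat) (mu : 'rV[R]_n) :
  weakly_decreasing (dominant mu) /\ exists w : 'S_n, dominant mu = col_perm w mu.
Proof.
set t := [tuple mu 0 j | j < n].
have tE : tval t = [seq mu 0 j | j <- enum 'I_n].
  by rewrite /t /=; congr map; rewrite enumT.
have szs : size (sort >=%R t) == n by rewrite size_sort size_tuple.
split.
  move=> i j le_ij; rewrite !mxE -tE.
  have srt : sorted >=%R (sort >=%R t).
    by apply: sort_sorted => x y; rewrite /= le_total.
  apply: (sorted_leq_nth _ _ _ srt) => //.
  - by move=> y x z /= xy yz; apply: le_trans yz xy.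
  - by move=> x /=.
  - by rewrite inE (eqP szs).
  - by rewrite inE (eqP szs).
have /tuple_permP [w ws] : perm_eq (Tuple szs) t by rewrite /= perm_sort.
exists w; apply/rowP => i; rewrite !mxE -tE.
have -> : sort >=%R t = [tuple tnth t (w k) | k < n] := ws.
by rewrite -tnth_nth !tnth_mktuple.
Qed.

Lemma dominant_unique (R : realType) (n : nat) (mu nu : 'rV[R]_n) (w : 'S_n) :
  nu = col_perm w mu -> weakly_decreasing nu -> nu = dominant mu.
Proof.
move=> nuE nud; apply/rowP => i; rewrite [RHS]mxE.
have pe : perm_eq [seq nu 0 j | j <- enum 'I_n] [seq mu 0 j | j <- enum 'I_n].
  rewrite (_ : [seq nu 0 j | j <- _] = [seq mu 0 j | j <- map w (enum 'I_n)]).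
    apply: perm_map; apply: uniq_perm; rewrite ?enum_uniq //.
      by rewrite map_inj_uniq ?enum_uniq //; apply: perm_inj.
    move=> x; rewrite mem_enum; apply/mapP; exists (w^-1 x)%g.
      by rewrite mem_enum.
    by rewrite permKV.
  by rewrite -[in RHS]map_comp; apply: eq_map => j /=; rewrite nuE mxE.
have srt : sorted >=%R [seq nu 0 j | j <- enum 'I_n].
  rewrite sorted_map sorted_pairwise; last by move=> y x z /= xy yz; exact: le_trans yz xy.
  apply/(pairwiseP i) => a b; rewrite !inE size_enum_ord => an bn ab /=.
  by apply: nud; rewrite !nth_enum_ord // ltnW.
rewrite (_ : sort _ _ = [seq nu 0 j | j <- enum 'I_n]).
  by rewrite (nth_map i) ?size_enum_ord // nth_ord_enum.
apply: (@sorted_eq _ >=%R) => //.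
- by move=> y x z /= xy yz; apply: le_trans yz xy.
- by move=> x y /= ; rewrite andbC; move/le_anti.
- by apply: sort_sorted => x y; rewrite /= le_total.
- by rewrite perm_sort perm_sym.
Qed.

Definition schmid (R : realType) (n : nat) (s : 'rV[R]_n) : Prop :=
  exists b : 'rV[int]_n,
    [/\ weakly_decreasing b,
        forall j : 'I_n, 0 <= b 0 j
      & forall j : 'I_n, s 0 j = (2 * b 0 j)%:~R].

Definition nb_nonzero (R : realType) (n : nat) (s : 'rV[R]_n) : nat :=
  #|[set j : 'I_n | s 0 j != 0]|.

(* Main.v *)
Require Import Defs.
From mathcomp Require Import all_boot all_order all_fingroup all_algebra.
From mathcomp Require Import reals.
From mathcomp Require Import lra.
Import Order.TTheory GRing.Theory Num.Theory.
Local Open Scope ring_scope.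

(** For every vector [v], the number [||v^+ + rho||^2] is, up to the constant
    [||rho||^2], the energy

      [sum_j (v_j^2 + (n + 1) v_j) + sum_(j < l) |v_j - v_l|].

    The sorting disappears: the energy is symmetric in the coordinates, and on
    a weakly decreasing vector the absolute values open up, so that the
    coordinate of index [j] (counted from 0) gets the total linear coefficient
    [(n + 1) + (n - 1 - j) - j = 2 (n - j)], twice that of [rho]
    ([sqr_enorm_rho], [energy_dominant]).

    It remains to compare the energies of [lambda - s] and [lambda]. The
    single terms change by [s_j (s_j - 2 lambda_j - (n + 1))], which is at
    least [s_j (2 - 2 lambda_1 - (n + 1))] because a nonzero [s_j] is at least
    2. For [j < l], put [x = lambda_j - lambda_l >= 0] and
    [d = s_j - s_l], which is 0 or at least 2. Then [|x - d| - |x|]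
    - is at least [- d >= - s_j] in general,
    - is at least 0 when [x <= 1], in particular when [l] lies in the first two
      blocks of [lambda] (this is where steps of length 2 matter),
    - equals [d] when [x = 0], hence [s_j] if moreover [s_l = 0].
    Suppose that the components of [s] beyond the first [i] vanish, at least
    within the first block. The [n - r] indices after the second block cost at
    most [s_j] each, and the [q - i] indices of the first block with [s_l = 0]
    gain [s_j] each, so the energy grows by at least

      [(sum_j s_j) (2 - 2 lambda_1 - (n + 1) + (q - i) - (n - r))]

    and the last factor is positive exactly when
    [lambda_1 < - n + (r + q - i + 1) / 2]. The second assertion is the case
    [i = q], in which nothing is required of [s] ([energy_sub_gt]). *)

(** * Sums over ordered pairs of indices *)

Lemma sum_const_ord_interval (V : nmodType) (n a b : nat) (x : V) :
  (b <= n)%N -> \sum_(l < n | (a <= l < b)%N) x = x *+ (b - a).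
Proof.
move=> le_bn; rewrite -(big_mkord (fun l => a <= l < b)%N (fun=> x)).
rewrite -sumr_const_nat (big_nat_widenl _ _ _ _ _ (leq0n a)).
by rewrite (big_nat_widen _ _ _ _ _ le_bn).
Qed.

Lemma sum_const_ord_gt (V : nmodType) (n : nat) (j : 'I_n) (x : V) :
  \sum_(l < n | (j < l)%N) x = x *+ (n - j.+1).
Proof.
rewrite -(sum_const_ord_interval V n j.+1 n x (leqnn n)).
by apply: eq_bigl => l; rewrite ltn_ord andbT.
Qed.

Lemma sum_const_ord_lt (V : nmodType) (n : nat) (l : 'I_n) (x : V) :
  \sum_(j < n | (j < l)%N) x = x *+ l.
Proof.
by rewrite -[in RHS](subn0 l) -(sum_const_ord_interval V n 0 l x (ltnW (ltn_ord l))).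
Qed.

Lemma sum_symmetric (V : nmodType) (n : nat) (F : 'I_n -> 'I_n -> V) :
  (forall j l, F j l = F l j) -> (forall j, F j j = 0) ->
  \sum_(j < n) \sum_l F j l = (\sum_(j < n) \sum_(l < n | (j < l)%N) F j l) *+ 2.
Proof.
move=> Fsym F0; rewrite mulr2n.
rewrite [X in _ = X + _](exchange_big_dep predT) //= -big_split /=.
apply: eq_bigr => j _; rewrite (bigID (fun l : 'I_n => (l < j)%N)) /=; congr (_ + _).
  by apply: eq_bigr => l _; rewrite Fsym.
rewrite (bigD1 j) ?ltnn //= F0 add0r; apply: eq_bigl => l.
by rewrite -leqNgt ltn_neqAle eq_sym andbC.
Qed.

(** * The energy of a vector *)

Definition energy (R : realType) (n : nat) (v : 'rV[R]_n) : R :=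
  \sum_j (v 0 j ^+ 2 + n.+1%:R * v 0 j)
  + \sum_(j < n) \sum_(l < n | (j < l)%N) `|v 0 j - v 0 l|.

(** Twice the pair sum of the energy is a sum over all ordered pairs, which a
    permutation of the indices merely reindexes. *)
Lemma energy_col_perm (R : realType) (n : nat) (w : 'S_n) (v : 'rV[R]_n) :
  energy R n (col_perm w v) = energy R n v.
Proof.
rewrite /energy; congr (_ + _).
  rewrite [RHS](reindex_inj (@perm_inj _ w)).
  by apply: eq_bigr => j _; rewrite !mxE.
have double (u : 'rV[R]_n) : \sum_(j < n) \sum_l `|u 0 j - u 0 l| =
    (\sum_(j < n) \sum_(l < n | (j < l)%N) `|u 0 j - u 0 l|) *+ 2.
  by apply: sum_symmetric => [j l|j]; rewrite ?subrr ?normr0 // distrC.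
apply/eqP; rewrite -(eqr_pMn2r (isT : (0 < 2)%N)) -!double; apply/eqP.
rewrite [RHS](reindex_inj (@perm_inj _ w)); apply: eq_bigr => j _.
rewrite [RHS](reindex_inj (@perm_inj _ w)); apply: eq_bigr => l _.
by rewrite !mxE.
Qed.

Lemma sqr_enorm (R : realType) (n : nat) (v : 'rV[R]_n) :
  enorm v ^+ 2 = \sum_j v 0 j ^+ 2.
Proof. by rewrite sqr_sqrtr // sumr_ge0 // => j _; rewrite sqr_ge0. Qed.

Lemma sum_pairs_decreasing (R : realType) (n : nat) (v : 'rV[R]_n) :
  weakly_decreasing v ->
  \sum_(j < n) \sum_(l < n | (j < l)%N) `|v 0 j - v 0 l| =
  \sum_j (v 0 j *+ (n - j.+1) - v 0 j *+ j).
Proof.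
move=> v_decr.
transitivity (\sum_(j < n) \sum_(l < n | (j < l)%N) (v 0 j - v 0 l)).
  apply: eq_bigr => j _; apply: eq_bigr => l lt_jl.
  by rewrite ger0_norm // subr_ge0 v_decr // ltnW.
under eq_bigr do rewrite sumrB sum_const_ord_gt.
rewrite !sumrB; congr (_ - _); rewrite (exchange_big_dep predT) //=.
by apply: eq_bigr => l _; rewrite sum_const_ord_lt.
Qed.

Lemma sqr_enorm_rho (R : realType) (n : nat) (v : 'rV[R]_n) :
  weakly_decreasing v ->
  enorm (v + rho R n) ^+ 2 = energy R n v + enorm (rho R n) ^+ 2.
Proof.
move=> v_decr; rewrite !sqr_enorm /energy sum_pairs_decreasing //.
rewrite -!big_split /=; apply: eq_bigr => j _; rewrite !mxE.
have lt_jn := ltn_ord j.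
rewrite -[v 0 j *+ _]mulr_natr -[v 0 j *+ j]mulr_natr !natrB ?(ltnW lt_jn) //.
by rewrite -!natr1; lra.
Qed.

Lemma energy_dominant (R : realType) (n : nat) (v : 'rV[R]_n) :
  energy R n (dominant v) = energy R n v.
Proof. by have [_ [w ->]] := dominantP v; exact: energy_col_perm. Qed.

(** * Growth of the energy *)

(** The distance from [x] to [d] against the distance from [x] to 0, when [d]
    is 0 or at least 2. The two Booleans record what is known of [x]: with
    [near] at most 1, with [zero] equal to 0. *)
Lemma dist_shift_ge (R : realType) (x d : R) (zero near : bool) :
  0 <= x -> (zero -> x = 0) -> (near -> x <= 1) -> (d = 0 \/ 2 <= d) ->
  zero%:R * d - (~~ near)%:R * d <= `|x - d| - `|x|.
Proof.
move=> x0 xz xn d2; rewrite (ger0_norm x0).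
have d0 : 0 <= d by case: d2 => [->|?] //; lra.
have := ler_norm (x - d); have := ler_norm (d - x); rewrite [`|d - x|]distrC.
case: zero xz => [/(_ isT) x_eq|_]; case: near xn => [/(_ isT) xn|_] /=;
  by case: d2 => ?; lra.
Qed.

(** Only [s_l >= 0] is used after the second block, and only [s_l = 0] on the
    gaining indices of the first block; both turn [s_j - s_l] into [s_j], which
    makes the bound linear in the single entry [s_j]. *)
Lemma sum_dist_shift_ge (R : realType) (n q r i : nat) (v s : 'rV[R]_n)
    (j : 'I_n) :
  (q <= r)%N -> (r <= n)%N -> (i <= q)%N ->
  weakly_decreasing v -> weakly_decreasing s -> (forall l, 0 <= s 0 l) ->
  (forall l : 'I_n, (j < l)%N -> s 0 j - s 0 l = 0 \/ 2 <= s 0 j - s 0 l) ->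
  (forall l : 'I_n, (j < l < q)%N -> v 0 j = v 0 l) ->
  (forall l : 'I_n, (j < l < r)%N -> v 0 j - v 0 l <= 1) ->
  (forall l : 'I_n, (i <= l < q)%N -> s 0 l = 0) ->
  s 0 j * (q%:R - i%:R - (n%:R - r%:R)) <=
  \sum_(l < n | (j < l)%N) (`|v 0 j - v 0 l - (s 0 j - s 0 l)| - `|v 0 j - v 0 l|).
Proof.
move=> qr rn iq v_decr s_decr s0 s2 vq vr sz.
have [sj0|sj_neq0] := eqVneq (s 0 j) 0.
  rewrite sj0 mul0r sumr_ge0 // => l jl.
  have -> : s 0 l = 0.
    by apply/eqP; rewrite eq_le s0 andbT -sj0 s_decr // ltnW.
  by rewrite subr0 subr0 subrr.
(* If [i < q], then [s] vanishes from the index [i] on, so that [j < i] and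
   all the gaining indices come after [j]; if [i = q], there are none. *)
have j_lt : (j < i)%N \/ i = q.
  have [ji|ij] := ltnP j i; first by left.
  right; apply/eqP; rewrite eqn_leq iq leqNgt; apply/negP => i_lt_q.
  have lt_in : (i < n)%N := leq_ltn_trans ij (ltn_ord j).
  case/eqP: sj_neq0; apply: le_anti; rewrite s0 andbT.
  rewrite -(sz (Ordinal lt_in)) /= ?leqnn //.
  exact: s_decr.
apply: (@le_trans _ _
    (\sum_(l < n | (j < l)%N) s 0 j * ((i <= l < q)%N%:R - (r <= l)%N%:R))).
  rewrite -mulr_sumr ler_wpM2l // sumrB lerB //.
    case: j_lt => [ji|->]; last by rewrite subrr sumr_ge0.
    rewrite -natrB // -(sum_const_ord_interval _ n) ?(leq_trans qr) //.
    rewrite big_mkcond [leRHS]big_mkcond /=; apply: ler_sum => l _.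
    case: ifP => [/andP[il _]|_]; last by case: ifP.
    by rewrite (leq_trans ji il).
  rewrite -natrB // -(sum_const_ord_interval _ n r n) //.
  rewrite big_mkcond [leRHS]big_mkcond /=; apply: ler_sum => l _.
  by rewrite ltn_ord andbT; case: ifP => _; case: (r <= l)%N.
apply: ler_sum => l jl.
have x0 : 0 <= v 0 j - v 0 l by rewrite subr_ge0 v_decr // ltnW.
have xq : (i <= l < q)%N -> v 0 j - v 0 l = 0.
  by case/andP=> _ lq; rewrite -vq ?subrr // jl.
have xr : (l < r)%N -> v 0 j - v 0 l <= 1 by move=> lr; rewrite vr // jl.
apply: le_trans _ (dist_shift_ge _ _ _ _ _ x0 xq xr (s2 l jl)).
rewrite -leqNgt mulrBr ![s 0 j * _]mulrC; apply: lerB.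
  by case: (boolP (i <= l < q)%N) => [/sz ->|_]; rewrite ?subr0 ?mul0r.
by rewrite ler_wpM2l // gerBl.
Qed.

(** The two assertions of the theorem differ only in [i]: for [i = q] the
    condition on the zeros of [s] is void. On the first two blocks, [v] is only
    asked to stay within 1 of its largest value [c]. *)
Lemma energy_sub_gt (R : realType) (n q r i : nat) (c : R) (v s : 'rV[R]_n) :
  (q <= r)%N -> (r <= n)%N -> (i <= q)%N ->
  weakly_decreasing v -> (forall l, v 0 l <= c) ->
  (forall l : 'I_n, (l < q)%N -> v 0 l = c) ->
  (forall l : 'I_n, (l < r)%N -> c - 1 <= v 0 l) ->
  schmid s -> s != 0 -> (forall l : 'I_n, (i <= l < q)%N -> s 0 l = 0) ->
  c < - n%:R + (r%:R + q%:R - i%:R + 1) / 2 ->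
  energy R n v < energy R n (v - s).
Proof.
move=> qr rn iq v_decr vc vq vr [b [b_decr b0 sE]] s_neq0 sz c_lt.
have s0 l : 0 <= s 0 l by rewrite sE ler0z mulr_ge0.
have s_decr : weakly_decreasing s.
  by move=> j l jl; rewrite !sE ler_int ler_pM2l // b_decr.
have even_gap (k : int) : 0 <= k -> (2 * k)%:~R = 0 :> R \/ 2 <= (2 * k)%:~R :> R.
  rewrite le_eqVlt => /predU1P [<-|k_gt0]; first by left; rewrite mulr0.
  by right; rewrite -[leLHS]/((2 * 1)%:~R) ler_int ler_pM2l.
rewrite -subr_gt0 /energy.
pose K : R := 1 - c *+ 2 - n%:R + (q%:R - i%:R - (n%:R - r%:R)).
have K_gt0 : 0 < K by rewrite /K; lra.
have sum_s_gt0 : 0 < \sum_j s 0 j.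
  rewrite lt_def sumr_ge0 // andbT psumr_eq0 //.
  apply: contraNN s_neq0 => /allP s_eq0; apply/eqP/rowP => j; rewrite mxE.
  by apply/eqP/s_eq0; rewrite mem_index_enum.
apply: (@lt_le_trans _ _ (\sum_j s 0 j * K)).
  by rewrite -mulr_suml mulr_gt0.
rewrite opprD addrACA -!sumrB -big_split /=; apply: ler_sum => j _.
rewrite -sumrB.
have -> : \sum_(l < n | (j < l)%N) (`|(v - s) 0 j - (v - s) 0 l| - `|v 0 j - v 0 l|) =
    \sum_(l < n | (j < l)%N) (`|v 0 j - v 0 l - (s 0 j - s 0 l)| - `|v 0 j - v 0 l|).
  apply: eq_bigr => l _; rewrite !mxE; congr (`|_| - _); lra.
have pairs : s 0 j * (q%:R - i%:R - (n%:R - r%:R)) <= \sum_(l < n | (j < l)%N)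
    (`|v 0 j - v 0 l - (s 0 j - s 0 l)| - `|v 0 j - v 0 l|).
  apply: sum_dist_shift_ge => // l.
  - move=> jl; rewrite !sE -intrB -mulrBr; apply: even_gap.
    by rewrite subr_ge0 b_decr // ltnW.
  - by case/andP=> jl lq; rewrite !vq // (ltn_trans jl lq).
  - by case/andP=> _ lr; have := vr l lr; have := vc j; lra.
have single : s 0 j * (1 - c *+ 2 - n%:R) <= ((v - s) 0 j) ^+ 2 +
    n.+1%:R * (v - s) 0 j - (v 0 j ^+ 2 + n.+1%:R * v 0 j).
  rewrite !mxE -natr1.
  have sv : s 0 j * v 0 j <= s 0 j * c by rewrite ler_wpM2l.
  have ss : s 0 j * 2 <= s 0 j * s 0 j.
    rewrite sE; case: (even_gap _ (b0 j)) => [->|ge2]; rewrite ?mul0r //.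
    by rewrite ler_wpM2l //; lra.
  lra.
by rewrite /K mulrDr lerD.
Qed.

(** The components of [s] decrease and are nonnegative: if that of index [l] is
    nonzero, so are all [l + 1 > i] components up to it. *)
Lemma schmid_nb_nonzero (R : realType) (n i : nat) (s : 'rV[R]_n) (l : 'I_n) :
  schmid s -> (nb_nonzero s <= i)%N -> (i <= l)%N -> s 0 l = 0.
Proof.
move=> [b [b_decr b0 sE]] nb il; apply/eqP/negPn/negP => sl.
have := leq_trans nb il; rewrite leqNgt => /negP; apply.
have <- : #|[set j : 'I_n | (j < l.+1)%N]| = l.+1.
  rewrite -sum1dep_card (sum_const_ord_interval _ n 0 l.+1) // subn0.
  by rewrite -mulr_natr mul1r natn.
apply: subset_leq_card; apply/subsetP => j; rewrite !inE ltnS => jl.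
apply: contraNneq sl => /eqP; rewrite !sE !intr_eq0 !mulf_eq0 /= => bj0.
by rewrite eq_le b0 andbT -(eqP bj0) b_decr.
Qed.

Theorem theorem3p6 (R : realType) (n : nat) (hn : (1 <= n)%N)
    (lambda : 'rV[R]_n) (q r : nat)
    (lambda1 := lambda 0 (Ordinal hn))
    (lambda_decr : weakly_decreasing lambda)
    (lambda_int : forall i j : 'I_n, lambda 0 i - lambda 0 j \is a Num.int)
    (hq : (1 <= q <= n)%N) (hr : (1 <= r <= n)%N) (hqr : (q <= r)%N)
    (block1 : forall j : 'I_n, (j < q)%N -> lambda 0 j = lambda1)
    (block2 : forall j : 'I_n, (q <= j < r)%N -> lambda 0 j = lambda1 - 1)
    (block3 : forall j : 'I_n, (r <= j)%N -> lambda 0 j <= lambda1 - 2) :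
  (forall i : nat, (1 <= i <= q)%N ->
     lambda1 < - n%:R + (r%:R + q%:R - i%:R + 1) / 2 ->
     forall s : 'rV[R]_n, schmid s -> s != 0 -> (nb_nonzero s <= i)%N ->
       enorm (dominant (lambda - s) + rho R n) ^+ 2 >
       enorm (lambda + rho R n) ^+ 2)
  /\
  (lambda1 < - n%:R + (r%:R + 1) / 2 ->
     forall s : 'rV[R]_n, schmid s -> s != 0 ->
       enorm (dominant (lambda - s) + rho R n) ^+ 2 >
       enorm (lambda + rho R n) ^+ 2).
Proof.
have /andP[_ rn] := hr.
have norm_gt (i : nat) (s : 'rV[R]_n) : (i <= q)%N ->
    lambda1 < - n%:R + (r%:R + q%:R - i%:R + 1) / 2 -> schmid s -> s != 0 ->
    (forall l : 'I_n, (i <= l < q)%N -> s 0 l = 0) ->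
    enorm (lambda + rho R n) ^+ 2 < enorm (dominant (lambda - s) + rho R n) ^+ 2.
  move=> iq lt1 sS s_neq0 sz.
  have [dom_decr _] := dominantP (lambda - s).
  rewrite !sqr_enorm_rho // energy_dominant ltrD2r.
  apply: (energy_sub_gt _ _ q r i lambda1) => // l; first exact: lambda_decr.
  move=> lr; have [lq|ql] := ltnP l q; first by rewrite block1 // gerBl.
  by rewrite block2 // ql lr.
split=> [i /andP[_ iq] lt1 s sS s_neq0 nb|lt1 s sS s_neq0].
  apply: (norm_gt i) => // l /andP[il _]; exact: (schmid_nb_nonzero _ _ _ _ _ sS nb il).
apply: (norm_gt q) => // [|l]; first by rewrite addrK.
by rewrite ltnNge andbN.
Qed.
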